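(* When $\operatorname{char}\mathcal{R}_2=p$ and $\beta=0$, we have $$\kappa=\begin{cases}\omega&\text{if }G(x)=0;\\ \min\{\omega,p^s-\omega+t\}&\text{if }G(x)\neq0.\end{cases}$$
   Context: $\mathcal{R}_2$ is a finite commutative chain ring with unity, with maximal ideal $\langle\gamma\rangle$, where $\gamma\neq0$ and $\gamma^2=0$; its residue field has order $p^m$, $p$ prime. $\zeta\in\mathcal{R}_2$ has multiplicative order $p^m-1$ and $\mathcal{T}_2=\{0,1,\zeta,\dots,\zeta^{p^m-2}\}$. $n,s$ are positive integers with $\gcd(n,p)=1$. $\alpha\in\mathcal{T}_2\setminus\{0\}$, $\beta\in\mathcal{T}_2$, $\lambda=\alpha+\gamma\beta$, and $\alpha_0\in\mathcal{T}_2$ satisfies $\alpha_0^{p^s}=\alpha$. Write $x^n-\alpha_0=f_1(x)\cdots f_r(x)$ with $f_j$ monic, pairwise coprime and basic irreducible (irreducible modulo $\gamma$) in $\mathcal{R}_2[x]$, $d_j=\deg f_j$. Then $x^{np^s}-\lambda=\prod_{j=1}^rk_j(x)$ with $k_j=f_j^{p^s}+\gamma g_j$ monic, pairwise coprime, of degree $d_jp^s$ (uniquely determined); when $\beta=0$ and $\operatorname{char}\mathcal{R}_2=p$ one has $k_j=f_j^{p^s}$. Fix $1\le j\le r$ and put $\mathcal{K}_j=\mathcal{R}_2[x]/\langle k_j(x)\rangle$. $\mathcal{P}_{d_j}(\mathcal{T}_2)$ denotes the set of polynomials with coefficients in $\mathcal{T}_2$ that are $0$ or of degree less than $d_j$.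 Let $0<\omega<p^s$, let $t\ge0$ be an integer, and let $G(x)$ be either $0$ or a unit of $\mathcal{K}_j$; $\kappa$ is the smallest integer with $0\le\kappa\le\omega$ and $\gamma f_j(x)^\kappa\in\langle f_j(x)^\omega+\gamma f_j(x)^tG(x)\rangle\subseteq\mathcal{K}_j$. If $G(x)\neq0$ it is assumed that $t<\kappa$ and $G(x)=\sum_{i=0}^{\kappa-t-1}a_i(x)f_j(x)^i$ with $a_i(x)\in\mathcal{P}_{d_j}(\mathcal{T}_2)$. *)

(* Defs.v *)
From HB Require Import structures.
From mathcomp Require Import all_boot all_order all_fingroup all_algebra.

Set Implicit Arguments.
Unset Strict Implicit.
Unset Printing Implicit Defensive.

Import GRing.Theory.
Local Open Scope ring_scope.

Section ChainRing.

Variable R : finComNzRingType.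

Definition gen_ideal (c : R) : {set R} := [set a * c | a : R].

(* [idealr_closed] describes proper ideals only; the unit ideal is comparable
   with every ideal, so nothing is lost. *)
Definition chain_ring : Prop :=
  forall I J : {set R}, idealr_closed (mem I) -> idealr_closed (mem J) ->
  I \subset J \/ J \subset I.

Definition maximal_ideal (M : {set R}) : Prop :=
  idealr_closed (mem M) /\
  forall J : {set R}, idealr_closed (mem J) -> M \subset J -> J = M.

(* For [zeta] of multiplicative order [q - 1], this is
   {0, 1, zeta, ..., zeta ^ (q - 2)}. *)
Definition teich (q : nat) (zeta : R) : {set R} :=
  0 |: [set zeta ^+ i | i : 'I_q.-1].

(* The polynomials that are 0 or of degree < d, with coefficients in T. *)
Definition poly_lt (d : nat) (T : {set R}) (a : {poly R}) : Prop :=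
  a \is a polyOver (mem T) /\ (size a <= d)%N.

Definition deg (f : {poly R}) : nat := (size f).-1.

(* [pi] presents the field [F] as the quotient of [R] by the ideal [M]. *)
Definition residue_map (M : {set R}) (F : finFieldType)
    (pi : {rmorphism R -> F}) : Prop :=
  (forall y : F, exists x : R, pi x = y) /\
  (forall x : R, pi x = 0 <-> x \in M).

Definition basic_irreducible (F : finFieldType) (pi : {rmorphism R -> F})
    (f : {poly R}) : Prop :=
  irreducible_poly (map_poly pi f).

End ChainRing.

Definition coprime_elts (A : comNzRingType) (x y : A) : Prop :=
  exists u v : A, u * x + v * y = 1.

(* [{poly %/ k}] has no canonical [unitRingType] structure over a ring that is
   not a field, so [GRing.unit] is not available there. *)
Definition is_unit (A : comNzRingType) (x : A) : Prop :=
  exists y : A, y * x = 1.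

Definition in_principal (A : comNzRingType) (y x : A) : Prop :=
  exists c : A, x = c * y.

Section Exponent.

Variables (R : finComNzRingType) (gamma : R) (k f : {poly R}).

(* [{poly %/ k}] is R[x]/<k> for [k] monic of positive degree. *)
Local Notation fbar := (in_qpoly k f).

Definition gamma_exp_in (omega t : nat) (G : {poly %/ k}) (e : nat) : Prop :=
  in_principal (fbar ^+ omega + gamma *: (fbar ^+ t * G)) (gamma *: fbar ^+ e).

Definition is_kappa (omega t : nat) (G : {poly %/ k}) (kappa : nat) : Prop :=
  [/\ (kappa <= omega)%N, gamma_exp_in omega t G kappa
    & forall e : nat, (e <= omega)%N -> gamma_exp_in omega t G e ->
        (kappa <= e)%N].

End Exponent.

(* Main.v *)
Require Import Defs.
From HB Require Import structures.
From mathcomp Require Import all_boot all_order all_fingroup all_algebra.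
From mathcomp Require Import ring zify.

(** Write q = p ^ s, w = omega, f = [f j], and g for gamma.

    In characteristic p with beta = 0, the q-th power of X^n - alpha0 is
    X^(n q) - alpha, so the powers [f i ^+ q] and the [k i] are two coprime
    monic factorizations of the same polynomial that agree modulo g.  Such a
    factorization is unique ([hensel_factor_eq]), so k_j = f^q and f^q = 0 in
    the quotient ring K.

    Upper bound: if G is a unit, multiplying f^w + g f^t G by f^(q-w) kills the
    first term and leaves g f^(q-w+t) G, so g f^(q-w+t) lies in the ideal
    ([gamma_exp_in_upper]).

    Lower bound: suppose g f^e = C (f^w + g f^t G) in K.  Reducing modulo g,
    where the coefficients form a field, f^(q-w) divides C, so that
    C = f^(q-w) h + g d.  Substituting, f^q = 0 and g^2 = 0 leave
    g f^e = g (d f^w + h G f^(q-w+t)), a multiple of f^M with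
    M = min(w, q-w+t) ([gamma_exp_in_lower]).  Since M <= q this persists
    in R[x], and comparing degrees after cancelling powers of the monic f
    gives M <= e ([scale_exp_monic_dvd]).

    If G = 0 the ideal does not depend on t, and the lower bound with t = w
    gives kappa >= w. *)

Set Implicit Arguments.
Unset Strict Implicit.
Unset Printing Implicit Defensive.

Import GRing.Theory.
Local Open Scope ring_scope.

(** * Coprime elements *)

Section CoprimeElts.

Variable A : comNzRingType.
Implicit Types x y z e : A.

Lemma coprime_elts1 x : coprime_elts x 1.
Proof. by exists 0, 1; ring. Qed.

Lemma coprime_eltsC x y : coprime_elts x y -> coprime_elts y x.
Proof. by case=> u [v uv]; exists v, u; rewrite addrC. Qed.

Lemma coprime_eltsM x y z :
  coprime_elts x y -> coprime_elts x z -> coprime_elts x (y * z).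
Proof.
move=> [u [v uv]] [u' [v' uv']].
exists (u + u' * (v * y)), (v * v').
by rewrite -uv -[v in RHS]mulr1 -uv'; ring.
Qed.

Lemma coprime_elts_prod (I : finType) (P : pred I) (F : I -> A) x :
  (forall i, P i -> coprime_elts x (F i)) ->
  coprime_elts x (\prod_(i | P i) F i).
Proof.
move=> xF; elim/big_rec: _ => [|i y Pi xy]; first exact: coprime_elts1.
by apply: coprime_eltsM => //; exact: xF.
Qed.

Lemma coprime_eltsX x y n : coprime_elts x y -> coprime_elts (x ^+ n) y.
Proof.
move=> xy; apply: coprime_eltsC.
elim: n => [|n IHn]; first by rewrite expr0; exact: coprime_elts1.
by rewrite exprS; apply: coprime_eltsM => //; exact: coprime_eltsC.
Qed.

(** A Bezout combination equal to 1 becomes, after the perturbation, equal to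
    [1 + u * e], which is invertible with inverse [1 - u * e]. *)
Lemma coprime_elts_nilp x y e :
  e ^+ 2 = 0 -> coprime_elts x y -> coprime_elts (x + e) y.
Proof.
move=> e2 [u [v uv]].
exists ((1 - u * e) * u), ((1 - u * e) * v).
have -> : (1 - u * e) * u * (x + e) + (1 - u * e) * v * y =
  (1 - u * e) * (u * x + v * y) + u * e - u ^+ 2 * e ^+ 2 by ring.
by rewrite uv e2; ring.
Qed.

(** From [u * x + v * y = 1], [z] is [x * (u * z)] plus [v * (z * y)]. *)
Lemma coprime_elts_dvd x y z w :
  coprime_elts x y -> z * y = x * w -> exists h, z = x * h.
Proof.
move=> [u [v uv]] zy; exists (u * z + v * w).
have -> : x * (u * z + v * w) = u * x * z + v * (x * w) by ring.
by rewrite -zy -[LHS]mul1r -uv; ring.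
Qed.

End CoprimeElts.

(** * Monic polynomials *)

Section Monic.

Variable R : comNzRingType.
Implicit Types f g h k : {poly R}.

Lemma size_monic_exp f n :
  f \is monic -> size (f ^+ n) = ((size f).-1 * n).+1.
Proof.
move=> fM; elim: n => [|n IHn]; first by rewrite expr0 size_poly1 muln0.
rewrite exprS size_monicM ?monic_neq0 ?monic_exp // IHn.
have : (0 < size f)%N by rewrite size_poly_gt0 monic_neq0.
by case: (size f) => // d _; rewrite /= mulnS !addnS.
Qed.

Lemma monic_dvd_eq k h :
  k \is monic -> k * h \is monic -> size (k * h) = size k -> k * h = k.
Proof.
move=> kM khM; have hM : h \is monic by rewrite -(monicMl h kM).
rewrite size_monicM ?monic_neq0 // => szkh.
have szk : (0 < size k)%N by rewrite size_poly_gt0 monic_neq0.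
have szh : size h = 1%N by lia.
have /eqP : lead_coef h = 1 by apply/monicP.
rewrite lead_coefE szh /= => /eqP h0.
by rewrite (size1_polyC (eq_leq szh)) h0 mulr1.
Qed.

(** If [e < M], cancelling [f ^+ e] would make a monic polynomial of positive
    degree divide a nonzero constant. *)
Lemma scale_exp_monic_dvd f (c : R) e M h :
    f \is monic -> (1 < size f)%N -> c != 0 ->
  c *: f ^+ e = f ^+ M * h -> (M <= e)%N.
Proof.
move=> fM szf c0 E; rewrite leqNgt; apply/negP => lt_eM.
have {}E : c%:P = f ^+ (M - e) * h.
  apply: (monic_lreg (monic_exp e fM)).
  by rewrite /= mulrA -exprD subnKC ?(ltnW lt_eM) // -E -mul_polyC mulrC.
have h0 : h != 0.
  by apply: contraNneq c0 => h0; rewrite -polyC_eq0 E h0 mulr0.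
have := size_polyC_leq1 c.
rewrite E size_monicM ?monic_exp // size_monic_exp //.
have : (0 < size h)%N by rewrite size_poly_gt0.
have : (0 < (size f).-1 * (M - e))%N by rewrite muln_gt0 subn_gt0 lt_eM; lia.
by lia.
Qed.

Lemma in_qpoly_eq k g h :
    k \is monic -> (1 < size k)%N -> in_qpoly k g = in_qpoly k h ->
  exists q, g = h + q * k.
Proof.
move=> kM szk /(congr1 val) /=.
rewrite /mk_monic szk kM => E.
exists (Pdiv.CommonRing.rdivp g k - Pdiv.CommonRing.rdivp h k).
rewrite [in LHS](Pdiv.RingMonic.rdivp_eq kM g) E.
by rewrite [in X in _ = X + _](Pdiv.RingMonic.rdivp_eq kM h); ring.
Qed.

Lemma in_qpolyK k : cancel (val : {poly %/ k} -> {poly R}) (in_qpoly k).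
Proof. by move=> G; apply: val_inj; exact: in_qpoly_small (size_mk_monic G). Qed.

Lemma in_qpolyXn_eq0 k f q : k = f ^+ q -> k \is monic -> (1 < size k)%N ->
  in_qpoly k f ^+ q = 0.
Proof.
move=> kE kM szk; rewrite -rmorphXn -kE; apply: val_inj => /=.
by rewrite /mk_monic szk kM Pdiv.RingMonic.rmodpp.
Qed.

End Monic.

(** * Uniqueness of the lifted factors *)

(** [k j] is coprime to the other factors [f i ^+ q], because it is a nilpotent
    perturbation of [f j ^+ q]; hence it divides [f j ^+ q], a monic
    polynomial of the same degree, and so equals it. *)
Lemma hensel_factor_eq (R : finComNzRingType) (gamma : R) (r : nat)
    (f k g : 'I_r -> {poly R}) (q : nat) (j : 'I_r) :
    gamma ^+ 2 = 0 ->
    (forall i, f i \is monic) -> (forall i, k i \is monic) ->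
    (forall i1 i2, i1 != i2 -> coprime_elts (f i1) (f i2)) ->
    (forall i, k i = f i ^+ q + gamma *: g i) ->
    (forall i, deg (k i) = (deg (f i) * q)%N) ->
    \prod_(i < r) f i ^+ q = \prod_(i < r) k i ->
  k j = f j ^+ q.
Proof.
move=> hgamma2 fM kM fcop kE kdeg Epr.
have cop : coprime_elts (k j) (\prod_(i < r | i != j) f i ^+ q).
  apply: coprime_elts_prod => i ij; rewrite kE.
  apply: coprime_elts_nilp; first by rewrite exprZn hgamma2 scale0r.
  apply/coprime_eltsX/coprime_eltsC/coprime_eltsX/fcop.
  exact: ij.
have [h hE] : exists h, f j ^+ q = k j * h.
  apply: (coprime_elts_dvd cop (w := \prod_(i < r | i != j) k i)).
  by move: Epr; rewrite (bigD1 j) // [in RHS](bigD1 j).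
rewrite hE; apply/esym/monic_dvd_eq; rewrite -?hE ?monic_exp //.
rewrite size_monic_exp // -[LHS]/((deg (f j) * q).+1) -kdeg /deg prednK //.
by rewrite size_poly_gt0 monic_neq0.
Qed.

(** * Reduction modulo gamma *)

Section Reduction.

Variables (R : finComNzRingType) (gamma : R).
Variables (F : finFieldType) (pi : {rmorphism R -> F}).
Hypothesis hpi : residue_map (gen_ideal gamma) pi.

Lemma map_residue_eq0 (c : {poly R}) :
  map_poly pi c = 0 -> exists d, c = gamma *: d.
Proof.
move=> pc0.
have cP (i : 'I_(size c)) : exists a, c`_i = gamma * a.
  have /(proj2 hpi)/imsetP[a _ ->] : pi c`_i = 0.
    by rewrite -coef_map pc0 coef0.
  by exists a; rewrite mulrC.
have [a aP] := fin_all_exists cP.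
exists (\sum_(i < size c) a i *: 'X^i).
rewrite -[LHS]coefK poly_def scaler_sumr; apply: eq_bigr => i _.
by rewrite aP scalerA.
Qed.

Lemma residue_gamma : pi gamma = 0.
Proof. by apply/(proj2 hpi)/imsetP; exists 1; rewrite ?mul1r. Qed.

(** [f ^+ w] is a non-zero-divisor modulo [gamma], since the residue ring is
    a domain and [f] stays monic there. *)
Lemma cancel_exp_mod_gamma (f a b c : {poly R}) w :
    f \is monic -> f ^+ w * a = f ^+ w * b + gamma *: c ->
  exists d, a = b + gamma *: d.
Proof.
move=> fM E.
have : map_poly pi (a - b) = 0.
  apply: (mulfI (monic_neq0 (monic_map pi (monic_exp w fM)))).
  rewrite -rmorphM mulrBr E addrAC subrr add0r mulr0 -mul_polyC rmorphM.
  by rewrite /= map_polyC /= residue_gamma mul0r.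
by move=> /map_residue_eq0[d dE]; exists d; rewrite -dE; ring.
Qed.

Hypotheses (hgamma : gamma != 0) (hgamma2 : gamma ^+ 2 = 0).

(** The lower bound on the exponent, lifted to R[x]: [H * f ^+ q] accounts for
    the relation [f ^+ q = 0] of the quotient ring. *)
Lemma exp_bound_poly (f C H G : {poly R}) (w t q e : nat) :
    f \is monic -> (1 < size f)%N -> (w <= q)%N ->
    gamma *: f ^+ e = C * (f ^+ w + gamma *: (f ^+ t * G)) + H * f ^+ q ->
  (minn w (q - w + t) <= e)%N.
Proof.
move=> fM szf w_q E.
have fq : f ^+ q = f ^+ w * f ^+ (q - w) by rewrite -exprD subnKC.
(* Modulo gamma the equation reads C * f ^+ w = - H * f ^+ q. *)
have [d Cd] : exists d, C = - H * f ^+ (q - w) + gamma *: d.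
  apply: (@cancel_exp_mod_gamma f _ _ (f ^+ e - C * (f ^+ t * G)) w fM).
  rewrite scalerBr E fq -!mul_polyC; ring.
set M := minn _ _.
have [fw fqt] : f ^+ w = f ^+ M * f ^+ (w - M) /\
    f ^+ (q - w + t) = f ^+ M * f ^+ (q - w + t - M).
  by rewrite -!exprD !subnKC ?geq_minl ?geq_minr.
have g2 : gamma%:P ^+ 2 = 0 :> {poly R} by rewrite -polyC_exp hgamma2.
apply: (@scale_exp_monic_dvd _ f gamma e M
  (gamma *: (d * f ^+ (w - M) - H * G * f ^+ (q - w + t - M))) fM szf hgamma).
have -> : f ^+ M * (gamma *: (d * f ^+ (w - M) - H * G * f ^+ (q - w + t - M)))
  = gamma *: (d * f ^+ w - H * G * f ^+ (q - w + t)).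
  by rewrite fw fqt -!mul_polyC; ring.
rewrite E Cd fq exprD -!mul_polyC.
(* The terms in f ^+ q cancel; the last summand dies as gamma ^+ 2 = 0. *)
transitivity (gamma%:P * (d * f ^+ w - H * G * (f ^+ (q - w) * f ^+ t))
  + gamma%:P ^+ 2 * (d * f ^+ t * G)); first by ring.
by rewrite g2 mul0r addr0.
Qed.

(** * The exponent kappa *)

Section Quotient.

Variables (f k : {poly R}) (w t q : nat).
Hypotheses (fM : f \is monic) (szf : (1 < size f)%N) (q0 : (0 < q)%N).
Hypotheses (kE : k = f ^+ q) (w_q : (w <= q)%N).
Implicit Type G : {poly %/ k}.

Let kM : k \is monic.
Proof. by rewrite kE monic_exp. Qed.

Let szk : (1 < size k)%N.
Proof. by rewrite kE size_monic_exp // ltnS muln_gt0 q0 andbT -subn1 subn_gt0. Qed.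

Lemma gamma_exp_in_lower G e :
  gamma_exp_in gamma f w t G e -> (minn w (q - w + t) <= e)%N.
Proof.
case=> C.
rewrite -[C]in_qpolyK -[G]in_qpolyK -!rmorphXn -rmorphM -!linearZ -rmorphD.
rewrite -rmorphM => /(in_qpoly_eq kM szk)[H E].
by apply: (@exp_bound_poly f (val C) H (val G) w t q e); rewrite -?kE.
Qed.

Lemma gamma_exp_in_upper G :
  is_unit G -> gamma_exp_in gamma f w t G (q - w + t).
Proof.
case=> y yG; exists (y * in_qpoly k f ^+ (q - w)).
set F0 := in_qpoly k f.
have Fq : F0 ^+ (q - w) * F0 ^+ w = 0.
  by rewrite -exprD subnK // (in_qpolyXn_eq0 kE kM szk).
rewrite mulrDr -mulrA Fq mulr0 add0r -scalerAr exprD; congr (_ *: _).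
by rewrite -[LHS]mul1r -yG; ring.
Qed.

End Quotient.

End Reduction.

Theorem proposition3p3
  (R : finComNzRingType) (gamma : R)
  (hchain : chain_ring R) (hmax : maximal_ideal (gen_ideal gamma))
  (hgamma : gamma != 0) (hgamma2 : gamma ^+ 2 = 0)
  (p m : nat) (hp : prime p)
  (F : finFieldType) (pi : {rmorphism R -> F})
  (hpi : residue_map (gen_ideal gamma) pi) (hF : #|F| = (p ^ m)%N)
  (zeta : R) (hzeta : (p ^ m - 1)%N.-primitive_root zeta)
  (n s : nat) (hn : (0 < n)%N) (hs : (0 < s)%N) (hnp : coprime n p)
  (alpha beta alpha0 : R)
  (halpha : alpha \in teich (p ^ m) zeta) (halpha_neq0 : alpha != 0)
  (hbeta : beta \in teich (p ^ m) zeta)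
  (halpha0 : alpha0 \in teich (p ^ m) zeta)
  (halpha0X : alpha0 ^+ (p ^ s) = alpha)
  (r : nat) (f : 'I_r -> {poly R})
  (hfprod : 'X^n - alpha0%:P = \prod_(i < r) f i)
  (hfmonic : forall i, f i \is monic)
  (hfcop : forall i1 i2, i1 != i2 -> coprime_elts (f i1) (f i2))
  (hfirr : forall i, basic_irreducible pi (f i))
  (k g : 'I_r -> {poly R})
  (hkprod : 'X^(n * p ^ s) - (alpha + gamma * beta)%:P = \prod_(i < r) k i)
  (hkE : forall i, k i = f i ^+ (p ^ s) + gamma *: g i)
  (hkmonic : forall i, k i \is monic)
  (hkcop : forall i1 i2, i1 != i2 -> coprime_elts (k i1) (k i2))
  (hkdeg : forall i, deg (k i) = (deg (f i) * p ^ s)%N)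
  (j : 'I_r) (omega t : nat) (homega : (0 < omega < p ^ s)%N)
  (G : {poly %/ k j}) (hG : G = 0 \/ is_unit G)
  (kappa : nat) (hkappa : is_kappa gamma (f j) omega t G kappa)
  (hGform : G <> 0 -> (t < kappa)%N /\
     exists a : 'I_(kappa - t) -> {poly R},
       (forall i, poly_lt (deg (f j)) (teich (p ^ m) zeta) (a i)) /\
       G = \sum_(i < kappa - t)
             in_qpoly (k j) (a i) * in_qpoly (k j) (f j) ^+ i)
  (hchar : p \in [pchar R]) (hbeta0 : beta = 0) :
  kappa = if G == 0 then omega else minn omega (p ^ s - omega + t).
Proof.
have q0 : (0 < p ^ s)%N by rewrite expn_gt0 prime_gt0.
have w_q : (omega <= p ^ s)%N by case/andP: homega => _ /ltnW.
have szf : (1 < size (f j))%N.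
  have [+ _] := hfirr j.
  by rewrite size_map_poly_id0 // (monicP (hfmonic j)) rmorph1 oner_eq0.
have kE : k j = f j ^+ (p ^ s).
  apply: (hensel_factor_eq j hgamma2 hfmonic hkmonic hfcop hkE hkdeg).
  have pnat_q : [pchar {poly R}].-nat (p ^ s)%N.
    by rewrite pnatX pnatE // pchar_poly hchar.
  rewrite prodrXl -hfprod -hkprod exprDn_pchar // exprNn_pchar //.
  by rewrite -exprM -polyC_exp halpha0X hbeta0 mulr0 addr0.
have [kap_w kap_in kap_min] := hkappa.
have [G0|/eqP G0] := eqVneq G 0.
  (* For G = 0 the parameter t is free; t = omega makes the minimum omega. *)
  have : gamma_exp_in gamma (f j) omega omega G kappa.
    by move: kap_in; rewrite /gamma_exp_in G0 !mulr0.
  move=> /(gamma_exp_in_lower hpi hgamma hgamma2 (hfmonic j) szf q0 kE w_q).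
  lia.
have low := gamma_exp_in_lower hpi hgamma hgamma2 (hfmonic j) szf q0 kE w_q kap_in.
have [//|uG] := hG.
have up := gamma_exp_in_upper gamma t (hfmonic j) szf q0 kE w_q uG.
apply/eqP; rewrite eqn_leq low andbT leq_min kap_w /=.
have [le_w|/ltnW lt_w] := leqP (p ^ s - omega + t) omega.
  exact: kap_min up.
exact: leq_trans kap_w lt_w.
Qed.
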